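(* Let $X$ be a Tychonoff space. If $X$ has precaliber $\omega_1$ and $P_\tau(X)$ is pseudocompact, then $P_\tau(X)$ is $C^*$-embedded in $P(\beta X)$.
   Context: $\beta X$ is the Stone–Čech compactification of $X$. $P(\beta X)$ is the set of Radon probability measures on the Borel $\sigma$-algebra of $\beta X$, with the weak topology, i.e. the topology generated by the functions $\mu\mapsto\int f\,d\mu$ for continuous $f:\beta X\to\mathbb R$. $P_\tau(X)$ is the subspace of all $\mu\in P(\beta X)$ such that $\mu(K)=0$ for every compact set $K\subset\beta X\setminus X$. A space is pseudocompact if every continuous real-valued function on it is bounded. A space $X$ has precaliber $\omega_1$ if every uncountable family of open subsets of $X$ has an uncountable subfamily with the finite intersection property (every nonempty finite subfamily has nonempty intersection). A subspace $Y\subset Z$ is $C^*$-embedded in $Z$ if every bounded continuous function $Y\to\mathbb R$ extends to a continuous function on $Z$. *)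

(* Defs.v *)
From HB Require Import structures.
From mathcomp Require Import all_boot all_order all_algebra.
From mathcomp Require Import all_classical all_reals all_analysis.

Set Implicit Arguments.
Unset Strict Implicit.
Unset Printing Implicit Defensive.

Import Order.TTheory GRing.Theory Num.Theory.
Import numFieldNormedType.Exports.

Local Open Scope classical_set_scope.
Local Open Scope ring_scope.

Definition tychonoff_space (T : topologicalType) : Prop :=
  hausdorff_space T /\ completely_regular_space T.

Definition pseudocompact (R : realType) (T : topologicalType) : Prop :=
  forall f : T -> R, continuous f -> bounded_fun f.

Definition precaliber_omega1 (T : topologicalType) : Prop :=
  forall F : set (set T), F `<=` open -> ~ countable F ->
  exists G : set (set T), [/\ G `<=` F, ~ countable G & finI G id].

Definition Cstar_embedded (R : realType) (Z : topologicalType) (Y : set Z)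
    : Prop :=
  forall g : Y -> R, continuous g -> bounded_fun g ->
  exists2 h : Z -> R, continuous h & forall y : Y, h (set_val y) = g y.

Section stone_cech.
Context (R : realType) (X : topologicalType).

Definition bounded_continuous : set (X -> R) :=
  [set f | continuous f /\ bounded_fun f].

Definition sc_cube : topologicalType :=
  prod_topology (fun _ : bounded_continuous => R).

Definition sc_eval (x : X) : sc_cube := fun f => set_val f x.

(* The Stone-Cech compactification: the closure of the image of X under the
   evaluation map into the product of copies of R indexed by C*(X).  It is
   compact because the f-th coordinate stays in a bounded interval. *)
Definition stone_cech : Type := closure (range sc_eval).

HB.instance Definition _ := Topological.on stone_cech.

Definition sc_embed (x : X) : stone_cech :=
  SigSub (mem_set (subset_closure (imageT sc_eval x))).

End stone_cech.

HB.instance Definition _ (R : realType) (X : ptopologicalType) :=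
  isPointed.Build (stone_cech R X) (sc_embed R (point : X)).

(* Measurable types of the library are pointed; this only leaves out empty
   spaces, which carry no probability measure. *)
Definition borel (K : ptopologicalType) := g_sigma_algebraType (@open K).

Section radon_probability.
Context (R : realType) (K : ptopologicalType).

Definition inner_regular (mu : set K -> \bar R) : Prop :=
  forall A : set K, <<s open >> A ->
  mu A = ereal_sup [set mu C | C in [set C | compact C /\ C `<=` A]].

(* A library measure is a function on all subsets; the second condition fixes
   its irrelevant values outside the Borel sigma-algebra, so that two elements
   are equal as soon as they agree on Borel sets. *)
Definition radon_prob : Type :=
  [set mu : probability (borel K) R |
    inner_regular mu /\ forall A : set K, ~ <<s open >> A -> mu A = 0%E].

HB.instance Definition _ := Choice.on radon_prob.

Definition radon_measure (mu : radon_prob) : probability (borel K) R :=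
  set_val mu.

Definition radon_integral (f : K -> R) (mu : radon_prob) : R :=
  \int[radon_measure mu]_x f x.

HB.instance Definition _ := Topological.copy radon_prob
  (sup_topology (fun f : [set f : K -> R | continuous f] =>
    Topological.class (initial_topology (radon_integral (set_val f))))).

End radon_probability.

Definition P_tau (R : realType) (X : ptopologicalType)
    : set (radon_prob R (stone_cech R X)) :=
  [set mu | forall C : set (stone_cech R X),
    compact C -> C `<=` ~` range (@sc_embed R X) -> radon_measure mu C = 0%E].
Arguments P_tau R X : clear implicits.

(* Main.v *)
(* Write [e] for the embedding of [X] into [beta X] and let [g] be a bounded
   continuous function on [P_tau X].  The argument is in the spirit of
   Glicksberg's theorem on products of pseudocompact spaces.

   1. Pseudocompactness of [P_tau X] passes to all finite powers of [X]: given
      open boxes in [X ^ n], cluster the means of [n] point masses placed in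
      them; the cluster measure charges, for each coordinate, the compact set of
      limits of the sides along one common ultrafilter, so each of these sets
      meets [X].
   2. Hence the largest change of [g] at a mean of point masses when one of its
      points [a] is moved to [b] (suitably weighted) is a continuous
      pseudometric [rho] on [X], totally bounded by pseudocompactness.  So the
      bounded-Lipschitz distance [W] that it induces on [P (beta X)] is
      continuous.
   3. If [W l l' = 0], then [l] and [l'] are simultaneously approximated by means
      of point masses at [x_i] and [y_i] in [X] with [rho x_i y_i = 0].  On such
      pairs [g] agrees; hence [g] is constant on the fibres of [W] in [P_tau X].
   4. Pseudocompactness, through inverses of positive functions, shows that every
      [l] in [P (beta X)] is at [W]-distance [0] from some [y] in [P_tau X], and
      that [g] is continuous for [W]; the extension sends [l] to [g y]. *)
From HB Require Import structures.
From mathcomp Require Import all_boot all_order all_algebra.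
From mathcomp Require Import all_classical all_reals all_analysis.
From mathcomp Require Import measurable_realfun.
From mathcomp Require Import lra.
Require Import Defs.

Set Implicit Arguments.
Unset Strict Implicit.
Unset Printing Implicit Defensive.

Import Order.TTheory GRing.Theory Num.Theory.
Import numFieldNormedType.Exports.

Local Open Scope classical_set_scope.
Local Open Scope ring_scope.

Lemma bounded_funP (R : realType) (T : Type) (f : T -> R) :
  bounded_fun f <-> exists M, forall x, `|f x| <= M.
Proof.
split=> [[M [_ bM]]|[M bM]].
  by exists (M + 1) => x; apply: (bM (M + 1)); rewrite ?ltrDl.
exists M; split; first exact: num_real.
by move=> N /ltW MN x _; exact: le_trans (bM x) MN.
Qed.

(** * The Stone-Cech compactification *)

Lemma continuous_to_initial (S : choiceType) (T W : topologicalType)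
    (f : S -> T) (g : W -> initial_topology f) :
  continuous (f \o g) -> continuous g.
Proof.
by move=> /continuousP cfg; apply/continuousP => _ [B oB <-]; exact: cfg.
Qed.

Lemma compact_set_type (T : topologicalType) (A : set T) :
  compact A -> compact [set: A].
Proof.
move=> cA F PF _.
have [p [Ap clp]] : A `&` cluster (set_val @ F) !=set0.
  apply: cA; apply: (@filterS _ F _ setT); last exact: filterT.
  by move=> x _; exact: set_valP.
exists (SigSub (mem_set Ap)); split => // B C FB [_ [[U oU <-] /= Up UC]].
have [_ [[b Bb <-] Ub]] : ((set_val : A -> T) @` B) `&` U !=set0.
  apply: clp; last exact: open_nbhs_nbhs.
  by apply: (@filterS _ F _ B) => // b Bb; exists b.
by exists b; split => //; exact: UC.
Qed.

Section stone_cech_theory.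
Context (R : realType) (X : topologicalType).
Local Notation B := (stone_cech R X).
Local Notation e := (@sc_embed R X).

Lemma sc_coord_continuous (f : @bounded_continuous R X) :
  continuous (fun z : B => (set_val z : sc_cube R X) f).
Proof.
move=> z; apply: (@continuous_comp B (sc_cube R X) R set_val (proj f)).
  exact: initial_continuous.
exact: proj_continuous.
Qed.

Lemma sc_embed_continuous : continuous e.
Proof.
apply: continuous_to_initial => x; apply/cvg_sup => f.
move: x; apply: continuous_to_initial => x.
by have [] := set_valP f.
Qed.

(** The coordinate of the cube indexed by [f] is the extension. *)
Lemma sc_extension (f : X -> R) : continuous f -> bounded_fun f ->
  exists2 F : B -> R, continuous F & forall x, F (e x) = f x.
Proof.
move=> cf bf; exists (fun z : B => (set_val z : sc_cube R X)
  (SigSub (mem_set (conj cf bf)))) => //; exact: sc_coord_continuous.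
Qed.

Lemma sc_embed_dense (U : set B) : open U -> U !=set0 -> exists x, U (e x).
Proof.
move=> [V oV <-] [z Vz].
have [_ [[x _ <-] Vx]] : range (@sc_eval R X) `&` V !=set0.
  by apply: (set_valP z); exact: open_nbhs_nbhs.
by exists x.
Qed.

(** By density: the points with [G z < F z] form an open set, which would meet [X] if it were
    nonempty. *)
Lemma sc_le (F G : B -> R) : continuous F -> continuous G ->
  (forall x, F (e x) <= G (e x)) -> forall z, F z <= G z.
Proof.
move=> cF cG FG z; rewrite leNgt; apply/negP => GFz.
have [||x /=] := @sc_embed_dense [set z | 0 < F z - G z].
- apply: (@open_comp _ _ (fun z => F z - G z) [set x | 0 < x]).
    by move=> y _; exact: (cvgB (cF y) (cG y)).
  exact: open_gt.
- by exists z; rewrite /= subr_gt0.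
- by rewrite subr_gt0 ltNge FG.
Qed.

Lemma sc_cube_hausdorff : hausdorff_space (sc_cube R X).
Proof.
apply: (@hausdorff_product _ (fun _ : @bounded_continuous R X => R)) => _.
exact: Rhausdorff.
Qed.

Lemma sc_hausdorff : hausdorff_space B.
Proof.
move=> p q clpq; apply: val_inj; apply: sc_cube_hausdorff => U V pU qV.
have [z [Uz Vz]] := clpq _ _ (initial_continuous pU) (initial_continuous qV).
by exists (val z).
Qed.

Lemma sc_compact : compact [set: B].
Proof.
(* [M f] bounds [f], so the range of [sc_eval] lies in a product [Q] of segments, compact by
   Tychonoff's theorem. *)
apply: compact_set_type; pose M (f : @bounded_continuous R X) : R :=
  xget 0 [set M | forall x, `|set_val f x| <= M].
have MP f x : `|set_val f x| <= M f.
  rewrite /M; case: xgetP => [m _ /(_ x)//|H].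
  have [_ /bounded_funP[m bm]] := set_valP f.
  by case: (H m).
pose Q : set (sc_cube R X) := [set z | forall f, `[- M f, M f]%classic (z f)].
have cQ : compact Q.
  apply: (@tychonoff _ (fun _ : @bounded_continuous R X => R)
    (fun f => `[- M f, M f]%classic)) => f; exact: segment_compact.
apply: (@subclosed_compact _ _ Q) => //; first exact: closed_closure.
have /closure_id -> : closed Q by apply: compact_closed => //; exact: sc_cube_hausdorff.
apply: closureS => _ [x _ <-] f.
by rewrite /= in_itv/= -ler_norml; exact: MP.
Qed.

Lemma sc_normal : normal_space B.
Proof. exact: compact_normal sc_hausdorff sc_compact. Qed.

End stone_cech_theory.

(** * Integrals against Radon probability measures *)

Section radon_theory.
Context (R : realType) (K : ptopologicalType).
Implicit Types (mu : radon_prob R K) (F G : K -> R).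

Lemma open_measurable_borel (U : set K) :
  open U -> measurable (U : set (borel K)).
Proof. by move=> oU; exact: sub_sigma_algebra. Qed.

Lemma closed_measurable_borel (C : set K) :
  closed C -> measurable (C : set (borel K)).
Proof.
move=> cC; rewrite -[C]setCK; apply: measurableC; apply: open_measurable_borel.
exact: closed_openC.
Qed.

Lemma continuous_borel_measurable F :
  continuous F -> measurable_fun [set: borel K] (F : borel K -> R).
Proof.
move=> /continuousP cF; apply: (measurability _ (RGenOpens.measurableE R)).
move=> _ [_ [a [b ->] <-]]; rewrite setTI; apply: open_measurable_borel.
exact/cF/interval_open.
Qed.

Hypothesis cK : compact [set: K].

Lemma compact_continuous_bounded F : continuous F ->
  exists M : R, forall z, `|F z| <= M.
Proof.
move=> cF.
have /compact_bounded [M [_ bM]] : compact (F @` [set: K]).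
  by apply: continuous_compact => //; exact: continuous_subspaceT.
by exists (M + 1) => z; apply: (bM (M + 1)); [rewrite ltrDl|exists z].
Qed.

Lemma integrable_continuous (m : probability (borel K) R) F : continuous F ->
  m.-integrable setT (EFin \o F).
Proof.
move=> cF; apply: measurable_bounded_integrable => //.
- by apply: (le_lt_trans (probability_le1 m measurableT)); exact: ltry.
- exact: continuous_borel_measurable.
- have [M bM] := compact_continuous_bounded cF.
  exists M; split; first exact: num_real.
  by move=> N /ltW MN z _; exact: le_trans (bM z) MN.
Qed.

Lemma radon_integralD mu F G : continuous F -> continuous G ->
  radon_integral (fun z => F z + G z) mu = radon_integral F mu + radon_integral G mu.
Proof. by move=> cF cG; apply: RintegralD => //; exact: integrable_continuous. Qed.

Lemma radon_integralB mu F G : continuous F -> continuous G ->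
  radon_integral (fun z => F z - G z) mu = radon_integral F mu - radon_integral G mu.
Proof. by move=> cF cG; apply: RintegralB => //; exact: integrable_continuous. Qed.

Lemma radon_integralZ mu (a : R) F : continuous F ->
  radon_integral (fun z => a * F z) mu = a * radon_integral F mu.
Proof. by move=> cF; apply: RintegralZl => //; exact: integrable_continuous. Qed.

Lemma radon_integral_cst mu (a : R) : radon_integral (fun=> a) mu = a.
Proof.
rewrite /radon_integral Rintegral_cst// -[RHS]mulr1; congr (_ * _).
by rewrite -[1]/(fine 1%:E); congr fine; exact: probability_setT.
Qed.

Lemma le_radon_integral mu F G : continuous F -> continuous G ->
  (forall z, F z <= G z) -> radon_integral F mu <= radon_integral G mu.
Proof.
by move=> cF cG FG; apply: le_Rintegral => //; exact: integrable_continuous.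
Qed.

Lemma dist_radon_integral mu F G (a : R) : continuous F -> continuous G ->
  (forall z, `|F z - G z| <= a) ->
  `|radon_integral F mu - radon_integral G mu| <= a.
Proof.
move=> cF cG FG; rewrite -radon_integralB//.
have cFG : continuous (fun z => F z - G z).
  by move=> z; exact: (cvgB (cF z) (cG z)).
have cc (b : R) : continuous (fun _ : K => b) by move=> t; exact: cvg_cst.
rewrite ler_norml -{2}(radon_integral_cst mu a) -(radon_integral_cst mu (- a)).
apply/andP; split; apply: le_radon_integral; try exact: cFG; try exact: cc;
  by move=> z; have := FG z; rewrite ler_norml => /andP[].
Qed.

Lemma radon_integral_continuous F : continuous F ->
  continuous (radon_integral F : radon_prob R K -> R).
Proof.
move=> cF mu A /= FA.
have /cvg_sup/(_ (SigSub (mem_set cF))) : nbhs mu --> mu by [].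
by apply; exact: (@initial_continuous _ _ (radon_integral F) mu A FA).
Qed.

Lemma radon_nbhsP (mu : radon_prob R K) (A : set (radon_prob R K)) : nbhs mu A ->
  exists (s : seq (K -> R)) (d : R), [/\ 0 < d,
    forall F, List.In F s -> continuous F &
    forall nu, (forall F, List.In F s ->
      `|radon_integral F nu - radon_integral F mu| < d) -> A nu].
Proof.
pose Bs : set_system (radon_prob R K) := [set A |
  exists (s : seq (K -> R)) (d : R), [/\ 0 < d,
    forall F, List.In F s -> continuous F &
    forall nu, (forall F, List.In F s ->
      `|radon_integral F nu - radon_integral F mu| < d) -> A nu]].
have FB : Filter Bs.
  split.
  - by exists [::], 1; split.
  - move=> P Q [s [d [d0 sc sP]]] [t [d' [d'0 tc tQ]]].
    exists (s ++ t), (Order.min d d'); split.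
    + by rewrite lt_min d0.
    + by move=> F /List.in_app_iff[]; [exact: sc|exact: tc].
    + move=> nu H; split; [apply: sP|apply: tQ] => F Fs.
        have := H F; rewrite lt_min => H'.
        by have /andP[] := H' (proj2 (List.in_app_iff _ _ _) (or_introl Fs)).
      have := H F; rewrite lt_min => H'.
      by have /andP[] := H' (proj2 (List.in_app_iff _ _ _) (or_intror Fs)).
  - move=> P Q PQ [s [d [d0 sc sP]]]; exists s, d; split => // nu /sP.
    exact: PQ.
suff H : Bs --> mu by move=> /H.
apply/cvg_sup => -[F cF] B [_ [[U oU <-] /= Umu UB]].
have cF' : continuous F by move/set_mem: (cF).
have /nbhs_ballP[d /= d0 dU] : nbhs (radon_integral F mu) U by exact: open_nbhs_nbhs.
exists [:: F], d; split => //.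
  by move=> G [<-//|[]].
move=> nu H; apply: UB; apply: dU; rewrite /ball/= distrC; apply: H.
by left.
Qed.

End radon_theory.

(** * Averages of finitely many point masses *)

Section average_of_points.
Context (R : realType) (K : ptopologicalType).
Variables (n : nat) (x : nat -> K).

Let weight_ge0 : 0 <= n.+1%:R^-1 :> R.
Proof. by rewrite invr_ge0. Qed.

Let m : {measure set (borel K) -> \bar R} :=
  mscale (NngNum weight_ge0) (msum (fun i => \d_(x i : borel K)) n.+1).

(** The value [0] off the Borel sets is the convention imposed in [radon_prob]. *)
Definition point_average (A : set (borel K)) : \bar R :=
  if `[< measurable A >] then
    m A
  else 0%E.

Let point_averageE (A : set (borel K)) : measurable A ->
  point_average A =
  m A.
Proof. by move=> mA; rewrite /point_average asboolT. Qed.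

Let point_average0 : point_average set0 = 0%E.
Proof. by rewrite point_averageE// measure0. Qed.

Let point_average_ge0 A : (0 <= point_average A)%E.
Proof. by rewrite /point_average; case: ifP. Qed.

Let point_average_sigma_additive : semi_sigma_additive point_average.
Proof.
move=> F mF tF mUF; rewrite point_averageE//.
rewrite (_ : (fun _ => _) = (fun k => \sum_(0 <= i < k) m (F i))%E).
  exact: (measure_semi_sigma_additive (s := m)).
by apply/funext => k; apply: eq_bigr => i _; rewrite point_averageE.
Qed.

HB.instance Definition _ := isMeasure.Build _ _ _ point_average
  point_average0 point_average_ge0 point_average_sigma_additive.

Lemma point_average_sum (A : set (borel K)) : measurable A ->
  point_average A = (n.+1%:R^-1 * \sum_(i < n.+1) (x i \in (A : set K))%:R)%:E.
Proof.
move=> mA; rewrite point_averageE// /m /mscale/= /msum EFinM -sumEFin.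
by congr (_ * _)%E.
Qed.

Let point_averageT : point_average setT = 1%E.
Proof.
rewrite point_average_sum//; congr EFin.
under eq_bigr do rewrite in_setT.
by rewrite sumr_const card_ord mulVf// pnatr_eq0.
Qed.

HB.instance Definition _ :=
  Measure_isProbability.Build _ _ _ point_average point_averageT.

Hypothesis hK : hausdorff_space K.

(** The points lying in [A] form a finite, hence compact, set that carries all the mass of [A]. *)
Lemma point_average_radon : inner_regular point_average /\
  forall A : set K, ~ <<s open >> A -> point_average A = 0%E.
Proof.
split=> [A mA|A nA]; last by rewrite /point_average asboolF.
apply/eqP; rewrite eq_le; apply/andP; split.
  pose C : set K := A `&` [set x i | i in `I_n.+1].
  have cC : compact C.
    by apply: finite_compact; apply: finite_setIr; exact/finite_image/finite_II.
  have mC : measurable (C : set (borel K)).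
    by apply: closed_measurable_borel; exact: compact_closed.
  apply: ereal_sup_ubound; exists C; first by split => // z [].
  rewrite !point_average_sum//.
  congr (_ * _)%:E; apply: eq_bigr => i _; congr (_%:R); congr nat_of_bool.
  apply/idP/idP => /set_mem; first by case=> Ax _; exact: mem_set.
  by move=> Ax; apply: mem_set; split => //; exists i => //=.
apply: ge_ereal_sup => _ [C [cC CA] <-]; apply: le_measure; rewrite ?inE//.
by apply: closed_measurable_borel; exact: compact_closed.
Qed.

Definition radon_average : radon_prob R K :=
  SigSub (mem_set point_average_radon).

Lemma radon_integral_average (cK : compact [set: K]) (F : K -> R) : continuous F ->
  radon_integral F radon_average = n.+1%:R^-1 * \sum_(i < n.+1) F (x i).
Proof.
move=> cF; have [M bM] := compact_continuous_bounded cK cF.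
have cM : continuous (fun _ : K => M) by move=> ?; exact: cvg_cst.
(* Adding the bound [M] makes the integrand nonnegative, as the integral formulas for scaled and
   summed measures require. *)
suff H : radon_integral (fun z => F z + M) radon_average =
    n.+1%:R^-1 * \sum_(i < n.+1) (F (x i) + M).
  move: H; rewrite radon_integralD// radon_integral_cst big_split/= mulrDr.
  rewrite sumr_const card_ord -[M *+ _]mulr_natr mulrCA mulVf ?pnatr_eq0// mulr1.
  exact: addIr.
have cFM : continuous (fun z => F z + M).
  by move=> z; exact: (cvgD (cF z) (cM z)).
have mFM : measurable_fun [set: borel K] (fun z : borel K => (F z + M)%:E).
  apply/measurable_EFinP; exact: continuous_borel_measurable.
have FM0 (z : borel K) : [set: borel K] z -> (0 <= (F z + M)%:E)%E.
  by move=> _; rewrite lee_fin; have := bM z; rewrite ler_norml; lra.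
rewrite /radon_integral /Rintegral -[RHS]/(fine (_%:E)); congr fine.
rewrite (@eq_measure_integral _ _ _ _ m); last first.
  by move=> A mA _; rewrite -point_averageE.
rewrite /m ge0_integral_mscale//= ge0_integral_measure_sum// EFinM -sumEFin.
congr (_ * _)%E; apply: eq_bigr => i _.
by rewrite integral_dirac// diracE in_setT mul1e.
Qed.

End average_of_points.

(** * Continuous functions and pseudocompact spaces *)

Lemma continuous_sumr (R : realType) (T : topologicalType) (I : Type)
    (r : seq I) (f : I -> T -> R) :
  (forall i, continuous (f i)) -> continuous (fun z => \sum_(i <- r) f i z).
Proof.
move=> cf; elim: r => [|i r ih] z.
  by under eq_fun do rewrite big_nil; exact: cvg_cst.
by under eq_fun do rewrite big_cons; exact: (cvgD (cf i z) (ih z)).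
Qed.

Lemma continuous_prodr (R : realType) (T : topologicalType) (I : Type)
    (r : seq I) (f : I -> T -> R) :
  (forall i, continuous (f i)) -> continuous (fun z => \prod_(i <- r) f i z).
Proof.
move=> cf; elim: r => [|i r ih] z.
  by under eq_fun do rewrite big_nil; exact: cvg_cst.
by under eq_fun do rewrite big_cons; exact: (cvgM (cf i z) (ih z)).
Qed.

Section pseudocompact_theory.
Context (R : realType) (T : topologicalType).
Hypothesis pT : pseudocompact R T.

(** The inverse of [u] is continuous, hence bounded. *)
Lemma pseudocompact_lower_bound (u : T -> R) : continuous u ->
  (forall z, 0 < u z) -> exists2 d, 0 < d & forall z, d <= u z.
Proof.
move=> cu u0.
have cV : continuous (fun z => (u z)^-1).
  by move=> z; apply: cvgV; [rewrite gt_eqF|exact: cu].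
have /bounded_funP[M bM] := pT cV.
have M0 : 0 < `|M| + 1 by rewrite ltr_pwDr.
exists (`|M| + 1)^-1; first by rewrite invr_gt0.
move=> z; rewrite -[u z]invrK lef_pV2 ?posrE ?invr_gt0//.
rewrite (le_trans (ler_norm _))// (le_trans (bM z))// (le_trans (ler_norm _))//.
by rewrite lerDl.
Qed.

(* Otherwise a locally finite sum of multiples of the [v k] is unbounded. *)
Lemma pseudocompact_cluster (v : nat -> T -> R) :
  (forall k, continuous (v k)) -> (forall k z, 0 <= v k z) ->
  (forall k, exists z, 0 < v k z) ->
  exists y : T, forall O, nbhs y O -> forall m : nat,
    exists k, (m <= k)%N /\ exists z, O z /\ 0 < v k z.
Proof.
move=> cv v0 /choice[a va]; apply: contrapT => /forallNP nocl.
have /choice[M MP] : forall y : T, exists m : nat,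
    \forall z \near y, forall k, (m <= k)%N -> v k z = 0.
  move=> y; have /existsNP[V /not_implyP[yV /existsNP[m nom]]] := nocl y.
  exists m; apply: filterS yV => z Vz k mk; apply/eqP.
  rewrite eq_le v0 andbT leNgt; apply/negP => vkz.
  by apply: nom; exists k; split => //; exists z.
have vM y k : (M y <= k)%N -> v k y = 0 by move: k; exact: nbhs_singleton (MP y).
(* Normalised so that the [k]-th term takes the value [k] at [a k]. *)
pose c k := k%:R / v k (a k).
have c0 k : 0 <= c k by rewrite divr_ge0// ltW.
pose S m z := \sum_(k < m) c k * v k z.
have SS z p q : (p <= q)%N -> (forall k, (p <= k)%N -> v k z = 0) ->
    S p z = S q z.
  move=> pq vp; rewrite /S -(subnKC pq) big_split_ord/= [X in _ + X]big1 ?addr0//.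
  by move=> i _; rewrite vp ?mulr0// leq_addr.
have SE z m : (forall k, (m <= k)%N -> v k z = 0) -> S m z = S (M z) z.
  move=> vm; have [mM|/ltnW Mm] := leqP m (M z); first exact: SS.
  by apply/esym/SS => // k; exact: vM.
have cS m : continuous (S m).
  by apply: continuous_sumr => i z; exact: (cvgM (cvg_cst _) (cv i z)).
(* Near [y] the cut-off [M z] may be replaced by the constant [M y]. *)
have cF : continuous (fun z => S (M z) z).
  move=> y.
  apply: cvg_trans (cS (M y) y); apply: near_eq_cvg.
  by apply: filterS (MP y) => z Mz; rewrite SE.
have /bounded_funP[B bB] := pT cF.
pose k := (Num.truncn B).+1.
have kM : (k < M (a k))%N.
  by rewrite ltnNge; apply/negP => /vM vk0; move: (va k); rewrite vk0 ltxx.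
have : k%:R <= S (M (a k)) (a k).
  rewrite /S (bigD1 (Ordinal kM))//= {1}/c divfK ?gt_eqF// lerDl.
  by apply: sumr_ge0 => i _; rewrite mulr_ge0.
have := bB (a k); rewrite ler_norml => /andP[_] /[swap] /le_trans /[apply].
by rewrite leNgt /k truncnS_gt.
Unshelve. all: by end_near. Qed.

End pseudocompact_theory.

(** * Pseudocompactness of the finite powers of X *)

Section tau_measures.
Context (R : realType) (X : ptopologicalType).
Hypothesis crX : completely_regular_space X.
Local Notation B := (stone_cech R X).
Local Notation e := (@sc_embed R X).
Local Notation Y := (P_tau R X).

(** If [f] separates [x] from the complement of [U], then [1 - f] extends to [beta X], with its
    bounds by density. *)
Lemma sc_bump (x : X) (U : set X) : open U -> U x ->
  exists F : B -> R, [/\ continuous F, forall z, 0 <= F z <= 1, F (e x) = 1 &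
    forall y, ~ U y -> F (e y) = 0].
Proof.
move=> oU Ux.
have /(@uniform_separatorP X R)[f [cf f01 f0 f1]] : uniform_separator [set x] (~` U).
  by apply: crX; [exact: open_closedC|exact].
have f01' y : 0 <= f y <= 1.
  have /f01 : range f (f y) by exists y.
  by rewrite /= in_itv.
have c1f : continuous (fun y => 1 - f y) by move=> y; exact: (cvgB (cvg_cst _) (cf y)).
have [|F cF FE] := @sc_extension R X (fun y => 1 - f y) c1f.
  apply/bounded_funP; exists 1 => y; have := f01' y.
  by rewrite ler_norml; lra.
have cc (b : R) : continuous (fun _ : B => b) by exact: cst_continuous.
exists F; split => //.
- move=> z; apply/andP; split.
    by apply: (sc_le (cc 0) cF) => y; rewrite FE; have := f01' y; lra.
  by apply: (sc_le cF (cc 1)) => y; rewrite FE; have := f01' y; lra.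
- by rewrite FE (f0 (f x)) ?subr0//; exists x.
- by move=> y nUy; rewrite FE (f1 (f y)) ?subrr//; exists y.
Qed.

Lemma P_tau_average (n : nat) (x : nat -> X) :
  Y (radon_average R n (e \o x) (@sc_hausdorff R X)).
Proof.
move=> C cC CX; rewrite /radon_measure/= point_average_sum; last first.
  by apply: closed_measurable_borel; exact: compact_closed (@sc_hausdorff R X) cC.
rewrite big1 ?mulr0// => i _; rewrite memNset//= => /CX; apply.
by exists (x i).
Qed.

Definition average n x : Y := SigSub (mem_set (P_tau_average n x)).

Definition tau_integral (F : B -> R) (y : Y) : R := radon_integral F (set_val y).

Lemma tau_integral_continuous F : continuous F -> continuous (tau_integral F).
Proof.
move=> cF y; apply: (@continuous_comp _ _ _ (set_val : Y -> _)).
  exact: initial_continuous.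
exact: radon_integral_continuous.
Qed.

Lemma tau_integral_average F n x : continuous F ->
  tau_integral F (average n x) = n.+1%:R^-1 * \sum_(i < n.+1) F (e (x i)).
Proof. by move=> cF; apply: radon_integral_average => //; exact: sc_compact. Qed.

End tau_measures.

Section ultrafilter_limits.
Context (R : realType) (X : ptopologicalType).
Local Notation B := (stone_cech R X).
Local Notation e := (@sc_embed R X).
Local Notation Y := (P_tau R X).

(** [f] is at most the indicator function of the complement of [D]. *)
Lemma radon_integral_le_measureC (mu : radon_prob R B) (D : set B) (f : B -> R) :
  compact D -> continuous f -> (forall z, f z <= 1) -> (forall z, D z -> f z <= 0) ->
  ((radon_integral f mu)%:E <= 1 - radon_measure mu D)%E.
Proof.
move=> cD cf f1 f0.
have mD : measurable (D : set (borel B)).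
  by apply: closed_measurable_borel; exact: compact_closed (@sc_hausdorff R X) cD.
have mDC : measurable (~` D : set (borel B)) by exact: measurableC.
rewrite -(probability_setC (radon_measure mu) mD).
rewrite -[radon_measure mu (~` D)]fineK ?fin_num_measure// lee_fin.
have -> : fine (radon_measure mu (~` D)) =
    \int[radon_measure mu]_x (\1_(~` D) x : R).
  by rewrite /Rintegral integral_indic// setIT.
apply: le_Rintegral => //.
- by apply: integrable_continuous => //; exact: sc_compact.
- apply: measurable_bounded_integrable => //.
    by apply: (le_lt_trans (probability_le1 _ measurableT)); exact: ltry.
  exists 1; split; first exact: num_real.
  move=> M /ltW M1 z _; apply: le_trans M1; rewrite /= indicE.
  by case: (_ \in _); rewrite ?normr1// normr0.
- move=> z _; rewrite indicE; have [zD|zD] := boolP (z \in ~` D); first exact: f1.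
  by apply: f0; move: zD; rewrite notin_setE => /contrapT.
Qed.

(* If the compact set of limits along [p] missed [X], it would be [mu]-null; an
   Urysohn function vanishing on a compact set of almost full mass off that set
   would then have a too small integral. *)
Lemma ultra_limit (p : set_system nat) (U : nat -> set X) (mu : Y) (a : R) :
  UltraFilter p -> 0 < a ->
  (forall f : B -> R, continuous f -> (forall z, 0 <= f z <= 1) ->
    forall S, p S ->
    (forall k x, S k -> U k x -> f (e x) = 1) -> a <= tau_integral f mu) ->
  exists z : X, forall S, p S ->
    closure (e @` [set x | exists k, S k /\ U k x]) (e z).
Proof.
move=> pU a0 H; pose E S := e @` [set x | exists k, S k /\ U k x].
pose C := \bigcap_(S in p) closure (E S).
have cB := @sc_compact R X; have hB := @sc_hausdorff R X.
have clC : closed C by apply: closed_bigI => S _; exact: closed_closure.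
have cC : compact C by apply: (subclosed_compact clC cB).
apply: contrapT => /forallNP nz.
have muC : radon_measure (set_val mu) C = 0%E.
  apply: (set_valP mu) => // y Cy [x _ exy]; apply: (nz x) => S pS.
  by rewrite exy; exact: Cy.
have mC : measurable (C : set (borel B)) by exact: closed_measurable_borel.
have muCC : radon_measure (set_val mu) (~` C) = 1%E.
  by have := probability_setC (radon_measure (set_val mu)) mC; rewrite muC sube0.
(* Inner regularity on the complement of [C], which has full measure. *)
have [_ [D [cD DC] <-] muD] : exists2 y, [set radon_measure (set_val mu) D |
    D in [set D | compact D /\ D `<=` ~` C]] y & ((1 - a / 2)%:E < y)%E.
  apply: ereal_sup_gt; rewrite -(proj1 (set_valP (set_val mu)) (~` C)).
    by rewrite muCC lte_fin; lra.
  exact: (measurableC mC).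
(* Otherwise the traces of these closures on [D] generate a proper filter, whose cluster point in
   [D] lies in [C]. *)
have [S pS DS] : exists2 S, p S & D `&` closure (E S) = set0.
  apply: contrapT => /forall2NP nS.
  pose F : set_system B := [set A | exists2 S, p S & D `&` closure (E S) `<=` A].
  have FF : ProperFilter F.
    split.
      by case=> S pS; rewrite subset0 => DS; have [] := nS S.
    split.
    - by exists setT; [exact: filterT|].
    - move=> P Q [S pS SP] [T pT TQ]; exists (S `&` T); first exact: filterI.
      move=> z [Dz cz]; split; [apply: SP|apply: TQ]; split => //;
        apply: closureS cz => _ [x [k [[Sk Tk] Ukx]] <-]; exists x => //; by exists k.
    - by move=> P Q PQ [S pS SP]; exists S => //; exact: subset_trans PQ.
  have [z [Dz Fz]] : D `&` cluster F !=set0.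
    by apply: cD; exists setT; [exact: filterT|move=> z []].
  apply: (DC _ Dz) => S pS.
  have clE : F (closure (E S)) by exists S => // ? [].
  rewrite ((closure_id (closure (E S))).1 (@closed_closure _ _)) => V zV.
  exact: Fz.
have clS : closed (closure (E S)) by exact: closed_closure.
have clD : closed D by exact: compact_closed hB cD.
(* A Urysohn function [f], zero on [D] and one on [E S], gives [a <= tau_integral f mu <= 1 - mu D <
   a / 2]. *)
have /normal_separatorP : normal_space B by exact: sc_normal.
move=> /(_ R _ _ clD clS DS) /(@uniform_separatorP B R)[f [cf f01 f0 f1]].
have f01' y : 0 <= f y <= 1.
  have /f01 : range f (f y) by exists y.
  by rewrite /= in_itv.
have : a <= tau_integral f mu.
  apply: (H f cf f01' S pS) => k x Sk Ukx; apply: (f1 (f (e x))); exists (e x) => //.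
  by apply: subset_closure; exists x => //; exists k.
have : ((tau_integral f mu)%:E <= 1 - radon_measure (set_val mu) D)%E.
  apply: radon_integral_le_measureC => // z; first by have /andP[] := f01' z.
  by move=> Dz; rewrite (f0 (f z))//; exists z.
have mD : measurable (D : set (borel B)) by exact: closed_measurable_borel.
move: muD; rewrite -[radon_measure _ D]fineK ?fin_num_measure//.
by rewrite lte_fin -EFinB lee_fin; lra.
Qed.

End ultrafilter_limits.

Section box_cluster.
Context (R : realType) (X : ptopologicalType).
Hypothesis crX : completely_regular_space X.
Local Notation B := (stone_cech R X).
Local Notation e := (@sc_embed R X).
Local Notation Y := (P_tau R X).
Hypothesis pY : pseudocompact R Y.

(** If this set of indices were not in [p], its complement would be. A bump supported in [N] is
    positive near [e z], so some side indexed by the complement would meet [N]. *)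
Lemma ultra_frequently (p : set_system nat) (U : nat -> set X) (z : X) (N : set X) :
  UltraFilter p ->
  (forall S, p S -> closure (e @` [set x | exists k, S k /\ U k x]) (e z)) ->
  open N -> N z -> p [set k | N `&` U k !=set0].
Proof.
move=> pU zU oN Nz; have [F [cF F01 Fz F0]] := sc_bump R crX oN Nz.
have [//|/zU clz] := in_ultra_setVsetC [set k | N `&` U k !=set0] pU.
have [|_ [[x [k [nk Ukx]] <-] /= Fx]] := clz [set y | 0 < F y].
  apply: open_nbhs_nbhs; split; last by rewrite /= Fz.
  by apply: (@open_comp _ _ F [set x | 0 < x]); [move=> y _; exact: cF|exact: open_gt].
exfalso; apply: nk; exists x; split => //.
by apply: contrapT => /F0 Fx0; rewrite Fx0 ltxx in Fx.
Qed.

(* Each finite power of [X] is pseudocompact: the mean of [n.+1] point masses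
   in the [k]-th box lies in an open subset of [Y] determined by bump functions
   supported in the sides of that box, and a cluster point of these open sets
   charges the limits of each side. *)
Lemma box_cluster (n : nat) (U : nat -> nat -> set X) :
  (forall k i, open (U k i)) -> (forall k i, U k i !=set0) ->
  exists z : nat -> X, forall N : nat -> set X,
    (forall i, open (N i) /\ N i (z i)) -> forall m : nat,
    exists2 k, (m <= k)%N & forall i, (i < n.+1)%N -> N i `&` U k i !=set0.
Proof.
move=> oU U0.
have /choice[a Ua] : forall ki : nat * nat, exists x, U ki.1 ki.2 x.
  by move=> ki; exact: U0.
have /choice[F FP] : forall ki : nat * nat, exists F : B -> R,
    [/\ continuous F, forall z, 0 <= F z <= 1, F (e (a ki)) = 1 &
     forall y, ~ U ki.1 ki.2 y -> F (e y) = 0].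
  by move=> ki; apply: sc_bump.
(* Positivity of [v k y] forces, for all [i] at once, the integral of [F (k, i)] to exceed
   [1 / n.+1 - 1 / k.+1]. *)
pose w k i (y : Y) := Num.max 0 (tau_integral (F (k, i)) y - (n.+1%:R^-1 - k.+1%:R^-1)).
pose v k (y : Y) := \prod_(i < n.+1) w k i y.
have n0 : 0 < n.+1%:R^-1 :> R by rewrite invr_gt0.
have cv k : continuous (v k).
  apply: continuous_prodr => i y; apply: (@continuous_max R Y (fun=> 0)
    (fun y => tau_integral (F (k, val i)) y - (n.+1%:R^-1 - k.+1%:R^-1))).
    exact: cst_continuous.
  have [cF _ _ _] := FP (k, val i).
  have cT := tau_integral_continuous cF.
  exact: (cvgB (cT y) (cvg_cst _)).
have w0 k i y : 0 <= w k i y by rewrite le_max lexx.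
have [] := pseudocompact_cluster pY cv.
- by move=> k z; apply: prodr_ge0.
- move=> k; exists (average R n (fun i => a (k, i))); apply: prodr_gt0 => i _.
  rewrite /w lt_max; apply/orP; right.
  have [cF F01 F1 _] := FP (k, val i).
  (* The bump is [1] at one of the [n.+1] points, so its mean is at least [1 / n.+1]. *)
  rewrite tau_integral_average// (bigD1 i)//= F1 mulrDr mulr1.
  have k0 : 0 < k.+1%:R^-1 :> R by rewrite invr_gt0.
  set s := _ * \sum_(_ < _ | _) _.
  suff s0 : 0 <= s.
    by clear -k0 s0; clearbody s; move: (n.+1%:R^-1) (k.+1%:R^-1) k0 => p q q0; lra.
  rewrite mulr_ge0 ?(ltW n0)// sumr_ge0// => j _.
  by have [_ + _ _] := FP (k, val i); move=> /(_ (e (a (k, val j))))/andP[].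
move=> mu muP.
(* The cluster property makes [G] proper. A single ultrafilter above it serves all coordinates, so
   that in the end one [k] works for every [i]. *)
pose G : set_system nat := [set A | exists2 V, nbhs mu V & exists m : nat,
  forall k, (m <= k)%N -> (exists y, V y /\ 0 < v k y) -> A k].
have GF : ProperFilter G.
  split.
    case=> V muV [m Vm]; have [k [mk Vk]] := muP _ muV m.
    exact: (Vm k).
  split.
  - by exists setT; [exact: filterT|exists 0%N].
  - move=> P Q [V muV [m VP]] [W muW [l WQ]]; exists (V `&` W); first exact: filterI.
    exists (maxn m l) => k; rewrite geq_max => /andP[mk lk] [y [[Vy Wy] vy]].
    by split; [apply: VP|apply: WQ] => //; exists y.
  - move=> P Q PQ [V muV [m VP]]; exists V => //; exists m => k mk Vk.
    by apply: PQ; exact: VP.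
have [p [pU Gp]] := ultraFilterLemma GF.
have /choice[z zP] : forall i, exists z : X, (i < n.+1)%N -> forall S, p S ->
    closure (e @` [set x | exists k, S k /\ U k i x]) (e z).
  move=> i; have [iltn|_] := boolP (i < n.+1)%N; last by exists point.
  have a20 : 0 < n.+1%:R^-1 / 2 :> R by rewrite divr_gt0.
  have [f cf f01 S pS fS|z zP] :=
    ultra_limit (p := p) (U := fun k => U k i) (mu := mu) pU a20; last by exists z.
  (* Otherwise some [y] near [mu] has [v k y > 0] and integral of [f] below [1 / (2 * n.+1)], with
     [k >= 2 * n.+1] in [S]. Since [F (k, i) <= f], this contradicts the threshold in [w k i]. *)
  rewrite leNgt; apply/negP => fmu.
  have [k [Sk [y [fy vy]]]] : exists k, S k /\ exists y,
      [/\ tau_integral f y < n.+1%:R^-1 / 2, 0 < v k y & (2 * n.+1 <= k)%N].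
    have pA : p [set k | exists y,
        [/\ tau_integral f y < n.+1%:R^-1 / 2, 0 < v k y & (2 * n.+1 <= k)%N]].
      apply: Gp; exists [set y | tau_integral f y < n.+1%:R^-1 / 2].
        apply: (tau_integral_continuous cf (x := mu) (t := [set t | t < n.+1%:R^-1 / 2])).
        apply: open_nbhs_nbhs; split => //.
      by exists (2 * n.+1)%N => k nk [y [fy vy]]; exists y.
    by have [k [Sk Ak]] := filter_ex (filterI pS pA); exists k.
  move=> nk; have : 0 < w k i y.
    rewrite lt_neqAle w0 andbT eq_sym; apply/eqP => wk0.
    by move: vy; rewrite /v (bigD1 (Ordinal iltn))//= wk0 mul0r ltxx.
  rewrite /w lt_max ltxx/=; have [cF F01 _ F0] := FP (k, i).
  have : tau_integral (F (k, i)) y <= tau_integral f y.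
    apply: le_radon_integral => //; first exact: sc_compact.
    apply: sc_le => // x; have [Ux|/F0->] := pselect (U k i x).
      by rewrite (fS k x)//; have /andP[] := F01 (e x).
    by have /andP[] := f01 (e x).
  have : k.+1%:R^-1 <= n.+1%:R^-1 / 2 :> R.
    rewrite -invfM lef_pV2 ?posrE ?mulr_gt0// -natrM ler_nat.
    by rewrite mulnC (leq_trans nk).
  by move: (n.+1%:R^-1) (k.+1%:R^-1) fy => q r; lra.
exists z => N NP m.
have pN : \forall k \near p, forall i : 'I_n.+1, [set k | N i `&` U k i !=set0] k.
  apply: filter_forall => i; apply: (ultra_frequently pU (zP i (ltn_ord i))); by have [] := NP i.
have pm : p [set k | (m <= k)%N].
  by apply: Gp; exists setT; [exact: filterT|exists m].
have [k [mk Nk]] := filter_ex (filterI pm pN).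
by exists k => // i iltn; exact: (Nk (Ordinal iltn)).
Qed.

End box_cluster.

(** * The exchange pseudometric *)

Section interchange_pseudometric.
Context (R : realType) (X : ptopologicalType).
Hypothesis crX : completely_regular_space X.
Local Notation B := (stone_cech R X).
Local Notation e := (@sc_embed R X).
Local Notation Y := (P_tau R X).
Hypothesis pY : pseudocompact R Y.

Lemma P_tau_nbhsP (y : Y) (A : set Y) : nbhs y A ->
  exists (s : seq (B -> R)) (d : R), [/\ 0 < d,
   forall F, List.In F s -> continuous F &
   forall y', (forall F, List.In F s ->
     `|tau_integral F y' - tau_integral F y| < d) -> A y'].
Proof.
case=> [_ [[U oU <-] /= Uy UA]].
have [|s [d [d0 sc sU]]] := @radon_nbhsP R B (set_val y) U.
  exact: open_nbhs_nbhs.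
by exists s, d; split => // y' /sU; exact: UA.
Qed.

Variable g : Y -> R.
Hypothesis cg : continuous g.

Let h n x := g (average R n x).

(** Finitely many test functions control [g] near the average; each varies by at most [c / 2] near
    each point, hence so does its mean. *)
Lemma average_near n (x : nat -> X) (d : R) : 0 < d ->
  exists2 N : nat -> set X, forall i, open (N i) /\ N i (x i) &
    forall x', (forall i, (i < n.+1)%N -> N i (x' i)) -> `|h n x' - h n x| < d.
Proof.
move=> d0; have /P_tau_nbhsP[s [c [c0 sc sP]]] :
    nbhs (average R n x) [set y | `|g (average R n x) - g y| < d].
  by have /cvgrPdist_lt/(_ d d0) := @cg (average R n x).
have near_s (a : X) : \forall b \near a, forall F, List.In F s ->
    `|F (e b) - F (e a)| <= c / 2.
  elim: s sc {sP} => [|F s ih] sc; first by apply: nearW => b F [].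
  have cFe : continuous (F \o e).
    move=> b; apply: continuous_comp; first exact: sc_embed_continuous.
    by apply: sc; left.
  have c20 : 0 < c / 2 by rewrite divr_gt0.
  have /cvgrPdist_le/(_ _ c20) Fa := cFe a.
  have sa := ih (fun G Gs => sc G (or_intror Gs)).
  apply: filterS2 Fa sa => b Fb sb G [<-|/sb//].
  by rewrite distrC.
have /choice[N NP] : forall i, exists N : set X, [/\ open N, N (x i) &
    forall b, N b -> forall F, List.In F s -> `|F (e b) - F (e (x i))| <= c / 2].
  move=> i; have := near_s (x i); rewrite /prop_near1 nbhsE => -[N [oN Nx] NP].
  by exists N; split.
exists N => [i|x' Nx']; first by have [] := NP i.
rewrite distrC; apply: (sP (average R n x')) => F Fs; have cF := sc _ Fs.
rewrite !tau_integral_average// -mulrBr -sumrB normrM ger0_norm ?invr_ge0//.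
apply: (@le_lt_trans _ _ (n.+1%:R^-1 * (n.+1%:R * (c / 2)))).
  rewrite ler_wpM2l ?invr_ge0//; apply: le_trans (ler_norm_sum _ _ _) _.
  rewrite mulr_natl -[X in _ *+ X]card_ord -sumr_const; apply: ler_sum => i _.
  have [_ _ NF] := NP i; apply: NF => //; exact: Nx'.
by rewrite mulKf ?pnatr_eq0// ltr_pdivrMr// ltr_pMr// ltr1n.
Qed.

Definition update (T : Type) (x : nat -> T) i (a : T) j := if j == i then a else x j.

(* If continuity at [x0] failed, one could choose points [a_k] in a decreasing
   sequence of neighbourhoods of [x0] and boxes around [update x i a_k] on which
   the mean of [g] stays away from its values at [x0]; a cluster point of the
   boxes is also one of the corresponding boxes at [x0]. *)
Lemma update_near n i (x0 : X) (eps : R) : (i < n.+1)%N -> 0 < eps ->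
  \forall a \near x0, forall x,
    `|h n (update x i a) - h n (update x i x0)| <= eps.
Proof.
move=> iltn eps0; apply: contrapT => nnear.
have e4 : 0 < eps / 4 by rewrite divr_gt0.
(* [D] records the next neighbourhood [V'] of [x0], the sides [U] of a box around [update x i a],
   and the values [r] and [s] of [h n] at [update x i a] and [update x i x0]. *)
pose stepP V (D : set X * (nat -> set X) * R * R) :=
  let: (V', U, r, s) := D in
  [/\ [/\ open V', V' x0 & V' `<=` V], (forall j, open (U j) /\ U j !=set0),
    U i `<=` V, eps < `|r - s| &
    (forall x, (forall j, (j < n.+1)%N -> U j (x j)) -> `|h n x - r| < eps / 4) /\
    (forall x, V' (x i) -> (forall j, (j < n.+1)%N -> j != i -> U j (x j)) ->
       `|h n x - s| < eps / 4)].
have /choice[f fP] : forall V, exists D, open V -> V x0 -> stepP V D.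
  move=> V; have [[oV Vx0]|nV] := pselect (open V /\ V x0); last first.
    by exists (setT, (fun=> setT), 0, 0) => oV Vx0; exfalso; apply: nV.
  have [a [x [Va hax]]] : exists a x, V a /\
      eps < `|h n (update x i a) - h n (update x i x0)|.
    apply: contrapT => nVa; apply: nnear; apply: filterS (open_nbhs_nbhs (conj oV Vx0)).
    move=> a Va x; rewrite leNgt; apply/negP => hax.
    by apply: nVa; exists a, x.
  have [N1 N1x N1P] := average_near n (update x i a) e4.
  have [N2 N2x N2P] := average_near n (update x i x0) e4.
  exists (V `&` N2 i, (fun j => if j == i then V `&` N1 i else N1 j `&` N2 j),
    h n (update x i a), h n (update x i x0)) => _ _; split => //.
  - have [op2 x2] := N2x i; split; [exact: openI| |by move=> z []].
    by split => //; move: x2; rewrite /update eqxx.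
  - move=> j; have [op1 x1] := N1x j; have [op2 x2] := N2x j; split.
      by case: eqP => [<-|_]; exact: openI.
    exists (update x i a j); move: x1 x2; rewrite /update.
    by case: eqP => [->|].
  - by rewrite eqxx => z [].
  - split=> z zP.
      apply: N1P => j jn; have := zP j jn; case: eqP => [->|_]; first by case.
      by case.
    move=> zj; apply: N2P => j jn; have [->|ji] := eqVneq j i; first by case: zP.
    by have := zj j jn ji; rewrite (negbTE ji) => -[].
pose V k := iter k (fun V => (f V).1.1.1) setT.
have VP k : open (V k) /\ V k x0.
  elim: k => [|k [oV Vx]]; first by split => //; exact: openT.
  by have := fP _ oV Vx; rewrite /V iterS -/(V k); case: (f (V k)) => -[[V' U] r] s /= [[]].
have {}fP : forall k, stepP (V k) (f (V k)).
  by move=> k; have [oV Vx] := VP k; exact: fP.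
have VS k l : (k <= l)%N -> V l `<=` V k.
  move=> kl; rewrite -(subnK kl); elim: (l - k)%N => [//|j ih]; apply: subset_trans ih.
  rewrite addSn /V iterS -/(V (j + k)%N).
  by have := fP (j + k)%N; case: (f (V (j + k)%N)) => -[[V' U] r] s /= [[]].
pose U k := (f (V k)).1.1.2.
have [||z zP] := box_cluster crX pY n (U := U).
- by move=> k j; have := fP k; rewrite /U; case: (f (V k)) => -[[V' W] r] s /= [_ /(_ j)[]].
- by move=> k j; have := fP k; rewrite /U; case: (f (V k)) => -[[V' W] r] s /= [_ /(_ j)[]].
have e8 : 0 < eps / 8 by rewrite divr_gt0.
have [N Nz NP] := average_near n z e8.
(* As [l > k], the [i]-th side of box [l] lies in [V k.+1]. So [h n] is near [r] at a point [x] of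
   box [k] and near [s] once its [i]-th coordinate becomes [b]; both values are near [h n z], whence
   [|r - s| < 3 * eps / 4]. *)
have [k _ kP] := zP N Nz 0%N; have [l kl lP] := zP N Nz k.+1.
have Uli : U l i `<=` V k.+1.
  apply: subset_trans (VS _ _ kl).
  by have := fP l; rewrite /U; case: (f (V l)) => -[[V' W] r] s /= [].
have /choice[x xP] : forall j, exists a, (j < n.+1)%N -> N j a /\ U k j a.
  move=> j; have [/kP[a]|_] := boolP (j < n.+1)%N; first by exists a.
  by exists point.
have [b [Nb Ub]] := lP i iltn.
have x1 : `|h n x - h n z| < eps / 8 by apply: NP => j /xP[].
have x2 : `|h n (update x i b) - h n z| < eps / 8.
  by apply: NP => j jn; rewrite /update; case: eqP => [->//|_]; have [] := xP j jn.
have := fP k; have := Uli _ Ub; move: xP; rewrite /U [V k.+1]iterS -/(V k).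
case: (f (V k)) => -[[V' W] r] s /= xP V'b [_ _ _ rs [/(_ x) r1 /(_ (update x i b)) s1]].
have {}r1 : `|h n x - r| < eps / 4 by apply: r1 => j /xP[].
have {}s1 : `|h n (update x i b) - s| < eps / 4.
  by apply: s1 => [|j jn ji]; rewrite /update ?eqxx ?(negbTE ji)//; have [] := xP j jn.
apply/negP: rs; rewrite -leNgt; move: x1 x2 r1 s1.
by rewrite ler_norml !ltr_norml; lra.
Qed.

End interchange_pseudometric.

Section exchange_distance.
Context (R : realType) (X : ptopologicalType).
Variable g : P_tau R X -> R.

(* The weight [1 / n.+1] makes large [n] negligible, so that continuity of the
   supremum only involves finitely many [n]. *)
Definition exchange_gaps (a b : X) : set R :=
  [set r | exists n i (x : nat -> X), (i < n.+1)%N /\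
    r = `|g (average R n (update x i a)) - g (average R n (update x i b))| / n.+1%:R].

Definition exchange_dist (a b : X) : R := sup (exchange_gaps a b).
Local Notation rho := exchange_dist.

Variable M : R.
Hypothesis gM : forall y, `|g y| <= M.

Lemma exchange_gap_le a b n i (x : nat -> X) : (i < n.+1)%N ->
  `|g (average R n (update x i a)) - g (average R n (update x i b))| / n.+1%:R
    <= 2 * M / n.+1%:R.
Proof.
move=> iltn; rewrite ler_pM2r ?invr_gt0//.
by rewrite (le_trans (ler_normB _ _))// mulrDl mul1r lerD.
Qed.

Lemma exchange_dist_ub a b n i (x : nat -> X) : (i < n.+1)%N ->
  `|g (average R n (update x i a)) - g (average R n (update x i b))| / n.+1%:R
    <= rho a b.
Proof.
move=> iltn; apply: ub_le_sup; last by exists n, i, x.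
exists (2 * M) => _ [m [j [y [jm ->]]]].
rewrite (le_trans (exchange_gap_le a b y jm))// ler_pdivrMr// ler_peMr ?ler1n//.
by rewrite mulr_ge0// (le_trans _ (gM (average R 0 y))).
Qed.

Lemma exchange_dist_le a b (c : R) :
  (forall n i (x : nat -> X), (i < n.+1)%N ->
  `|g (average R n (update x i a)) - g (average R n (update x i b))| / n.+1%:R
    <= c) -> rho a b <= c.
Proof.
move=> H; apply: ge_sup => [|_ [n [i [x [iltn ->]]]]]; last exact: H.
by exists (`|g (average R 0 (update (fun=> a) 0 a)) -
    g (average R 0 (update (fun=> a) 0 b))| / 1%:R),
  0%N, 0%N, (fun=> a).
Qed.

Lemma exchange_dist_ge0 a b : 0 <= rho a b.
Proof.
apply: le_trans (exchange_dist_ub a b (fun=> a) (ltnSn 0)).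
by rewrite divr_ge0.
Qed.

Lemma exchange_distxx a : rho a a = 0.
Proof.
apply/le_anti; rewrite exchange_dist_ge0 andbT.
by apply: exchange_dist_le => n i x _; rewrite subrr normr0 mul0r.
Qed.

Lemma exchange_distC a b : rho a b = rho b a.
Proof.
by apply/le_anti/andP; split; apply: exchange_dist_le => n i x iltn;
  rewrite distrC; exact: exchange_dist_ub.
Qed.

Lemma exchange_dist_triangle b a c : rho a c <= rho a b + rho b c.
Proof.
apply: exchange_dist_le => n i x iltn.
apply: le_trans (lerD (exchange_dist_ub a b x iltn) (exchange_dist_ub b c x iltn)).
by rewrite -mulrDl ler_pM2r ?invr_gt0// ler_distD.
Qed.

Hypothesis crX : completely_regular_space X.
Hypothesis pY : pseudocompact R (P_tau R X).
Hypothesis cg : continuous g.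

(** The points are exchanged one at a time, each time with gap [0]. *)
Lemma exchange_dist0 n (x y : nat -> X) : (forall i, rho (x i) (y i) = 0) ->
  g (average R n x) = g (average R n y).
Proof.
move=> xy; have step i (z : nat -> X) : (i < n.+1)%N ->
    g (average R n (update z i (x i))) = g (average R n (update z i (y i))).
  move=> iltn; have := exchange_dist_ub (x i) (y i) z iltn.
  by rewrite xy pmulr_lle0 ?invr_gt0// normr_le0 subr_eq0 => /eqP.
pose z k i := if (i < k)%N then y i else x i.
have zE k : (k <= n.+1)%N -> g (average R n (z k)) = g (average R n x).
  elim: k => [//|k ih] kn; rewrite -ih; last exact: ltnW.
  have -> : z k.+1 = update (z k) k (y k).
    apply/funext => i; rewrite /z /update ltnS leq_eqVlt.
    by case: eqP => [->|].
  rewrite -step//; congr (g (average R n _)); apply/funext => i.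
  by rewrite /z /update; case: eqP => [->|//]; rewrite ltnn.
rewrite -(zE n.+1)//.
(* [z n.+1] and [y] may differ beyond index [n], which [average_near] ignores. *)
apply/eqP; rewrite -subr_eq0 -normr_le0; apply/ler_addgt0Pl => d d0; rewrite addr0.
have [N Ny NP] := average_near cg n y d0; apply/ltW/NP => i iltn.
by rewrite /z iltn; have [] := Ny i.
Qed.

(** From [m] on, the weight alone makes the gaps at most [eps]; below [m] there are finitely many
    pairs of [n] and [i], each settled by [update_near]. *)
Lemma exchange_dist_near (b : X) (eps : R) : 0 < eps ->
  \forall a \near b, rho a b <= eps.
Proof.
move=> eps0; pose m := (Num.truncn (2 * M / eps)).+1.
have nr : \forall a \near b, forall n : 'I_m, forall i : 'I_n.+1,
    forall x, `|g (average R n (update x i a)) - g (average R n (update x i b))| <= eps.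
  apply: filter_forall => n; apply: filter_forall => i.
  exact: (update_near crX pY cg).
apply: filterS nr => a na; apply: exchange_dist_le => n i x iltn.
have [nm|mn] := ltnP n m.
  rewrite ler_pdivrMr// (le_trans (na (Ordinal nm) (Ordinal iltn) x))//.
  by rewrite ler_peMr ?ler1n// ltW.
apply: le_trans (exchange_gap_le a b x iltn) _.
rewrite ler_pdivrMr// [eps * _]mulrC -ler_pdivrMr//.
apply: ltW; apply: (lt_le_trans (truncnS_gt _)).
by rewrite ler_nat (leq_trans mn).
Qed.

End exchange_distance.

(** * The bounded-Lipschitz distance between measures *)

Section lipschitz_distance.
Context (R : realType) (X : ptopologicalType).
Hypothesis crX : completely_regular_space X.
Local Notation B := (stone_cech R X).
Local Notation e := (@sc_embed R X).
Local Notation K := (radon_prob R B).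
Hypothesis pY : pseudocompact R (P_tau R X).

Variable rho : X -> X -> R.
Hypotheses (rho_ge0 : forall a b, 0 <= rho a b) (rhoxx : forall a, rho a a = 0)
  (rhoC : forall a b, rho a b = rho b a)
  (rho_triangle : forall b a c, rho a c <= rho a b + rho b c)
  (rho_near : forall b eps, 0 < eps -> \forall a \near b, rho a b <= eps).

Lemma pseudometric_continuous b : continuous (fun a => rho a b).
Proof.
move=> a; apply/cvgrPdist_le => eps eps0; apply: filterS (rho_near a eps0) => c ca.
rewrite ler_norml; have := rho_triangle c a b; have := rho_triangle a c b.
by rewrite (rhoC a c); lra.
Qed.

Lemma pseudometric_open_ball b (r : R) : open [set a | rho a b < r].
Proof.
apply: (@open_comp _ _ (fun a => rho a b) [set t | t < r]); last exact: open_lt.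
by move=> a _; exact: pseudometric_continuous.
Qed.

(** Otherwise there is an [eps]-separated sequence. Some ball of radius [eps / 4] then meets the
    [eps / 4]-balls around two of its terms, whose distance is therefore below [eps]. *)
Lemma pseudometric_net (eps : R) : 0 < eps ->
  exists s : seq X, forall a, exists2 b, b \in s & rho a b <= eps.
Proof.
move=> eps0; apply: contrapT => /forallNP nonet.
have /choice[f fP] : forall s : seq X, exists a, forall b, b \in s -> eps < rho a b.
  move=> s; have /existsNP[a /forall2NP na] := nonet s.
  by exists a => b bs; rewrite ltNge; apply/negP => ab; have [] := na b.
pose s k := iter k (fun s => f s :: s) [::]; pose a k := f (s k).
have as_ j k : (j < k)%N -> a j \in s k.
  elim: k => // k ih; rewrite ltnS leq_eqVlt => /predU1P[->|/ih jk].
    by rewrite /s iterS -/(s k) mem_head.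
  by rewrite /s iterS -/(s k) in_cons jk orbT.
have e4 : 0 < eps / 4 by rewrite divr_gt0.
have [||z zP] := box_cluster crX pY 0 (U := fun k _ => [set x | rho x (a k) < eps / 4]).
- by move=> k _; exact: pseudometric_open_ball.
- by move=> k _; exists (a k); rewrite /= rhoxx.
pose N := fun i : nat => [set x | rho x (z i) < eps / 4].
have NP i : open (N i) /\ N i (z i).
  by split; [exact: pseudometric_open_ball|rewrite /N/= rhoxx].
have [j _ /(_ 0%N erefl)[x [/= xz xj]]] := zP N NP 0%N.
have [k jk /(_ 0%N erefl)[y [/= yz yk]]] := zP N NP j.+1.
have := fP _ _ (as_ _ _ jk); rewrite -/(a k); rewrite /N/= in xz yz.
have := rho_triangle y (a k) (a j); have := rho_triangle (z 0%N) y (a j).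
have := rho_triangle x (z 0%N) (a j); rewrite (rhoC (a k) y) (rhoC (z 0%N) x).
by lra.
Qed.

(** [rho] lives on [X], so the Lipschitz condition is imposed there only; [short_dist] is the
    bounded-Lipschitz distance dual to [rho]. *)
Definition short_functions : set (B -> R) :=
  [set F | [/\ continuous F, forall a b, `|F (e a) - F (e b)| <= rho a b &
    forall z, `|F z| <= 1]].

Definition short_gaps (l l' : K) : set R :=
  [set `|radon_integral F l - radon_integral F l'| | F in short_functions].

Definition short_dist (l l' : K) : R := sup (short_gaps l l').

Lemma short_dist_ub F l l' : short_functions F ->
  `|radon_integral F l - radon_integral F l'| <= short_dist l l'.
Proof.
move=> sF; apply: ub_le_sup; last by exists F.
exists 2 => _ [G [cG _ G1] <-].
have cB := @sc_compact R X.
have H m : `|radon_integral G m| <= 1.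
  have := dist_radon_integral cB m cG (@cst_continuous B R 0).
  rewrite radon_integral_cst => /(_ 1); rewrite subr0; apply => z.
  by rewrite subr0.
have := H l; have := H l'; rewrite !ler_norml; lra.
Qed.

Lemma short_dist_le l l' (c : R) : (forall F, short_functions F ->
  `|radon_integral F l - radon_integral F l'| <= c) -> short_dist l l' <= c.
Proof.
move=> H; apply: ge_sup => [|_ [F sF <-]]; last exact: H.
exists `|radon_integral (fun=> 0) l - radon_integral (fun=> 0) l'|, (fun=> 0) => //.
split => [|a b|z]; [exact: cst_continuous|by rewrite subrr normr0|by rewrite normr0].
Qed.

Lemma short_dist_ge0 l l' : 0 <= short_dist l l'.
Proof.
apply: le_trans (normr_ge0 _) (short_dist_ub l l' (F := fun=> 0) _).
by split => [|a b|z]; [exact: cst_continuous|rewrite subrr normr0|rewrite normr0].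
Qed.

Lemma short_distC l l' : short_dist l l' = short_dist l' l.
Proof.
by apply/le_anti/andP; split; apply: short_dist_le => F sF;
  rewrite distrC; exact: short_dist_ub.
Qed.

Lemma short_distxx l : short_dist l l = 0.
Proof.
apply/le_anti; rewrite short_dist_ge0 andbT; apply: short_dist_le => F _.
by rewrite subrr normr0.
Qed.

Lemma short_dist_triangle m l l' : short_dist l l' <= short_dist l m + short_dist m l'.
Proof.
apply: short_dist_le => F sF.
apply: le_trans (lerD (short_dist_ub l m sF) (short_dist_ub m l' sF)).
exact: ler_distD.
Qed.

(* Rounded values on a finite net of [X] sort the short functions into finitely
   many classes of small diameter. *)
Lemma short_dist_near (l : K) (eps : R) : 0 < eps ->
  \forall m \near l, short_dist m l <= eps.
Proof.
move=> eps0; pose d := eps / 8; have d0 : 0 < d by rewrite divr_gt0.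
have [s sP] := pseudometric_net d0.
pose N := (Num.truncn (2 / d)).+1.
pose code (F : B -> R) : {ffun 'I_(size s) -> 'I_N} :=
  [ffun j : 'I_(size s) => inord (Num.truncn ((F (e (nth point s j)) + 1) / d))].
(* Equal codes leave a difference of at most [d] at net points, and each function moves by at most
   [d] from a point of [X] to the net. *)
have code_dist F G : short_functions F -> short_functions G -> code F = code G ->
    forall z, `|F z - G z| <= 3 * d.
  move=> [cF FL F1] [cG GL G1] FG.
  have codeP H : (forall z, `|H z| <= 1) -> forall j : 'I_(size s),
      d * (code H j)%:R <= H (e (nth point s j)) + 1 < d * (code H j)%:R + d.
    move=> H1 j; have := H1 (e (nth point s j)); rewrite ler_norml => /andP[Hl Hu].
    set q := H (e (nth point s j)) + 1.
    have q0 : 0 <= q / d by rewrite divr_ge0 ?(ltW d0)// /q; lra.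
    have qN : (Num.truncn (q / d) < N)%N.
      by rewrite ltnS; apply: le_truncn; rewrite ler_pM2r ?invr_gt0// /q; lra.
    have := truncn_itv q0; rewrite ffunE inordK// ler_pdivlMr// ltr_pdivrMr//.
    by rewrite -natr1; move: (_%:R) => t; lra.
  have cFG : continuous (fun z => `|F z - G z|).
    by move=> z; exact: (cvg_norm (cvgB (cF z) (cG z))).
  apply: (sc_le cFG (@cst_continuous B R (3 * d))) => x.
  have [b bs xb] := sP x; have jn : (index b s < size s)%N by rewrite index_mem.
  have := codeP F F1 (Ordinal jn); have := codeP G G1 (Ordinal jn); rewrite FG/= nth_index//.
  have := le_trans (FL x b) xb; have := le_trans (GL x b) xb.
  by rewrite !ler_norml; lra.
(* One representative per class; codes of no short function get the default [0]. *)
have /choice[rep repP] : forall c, exists G, (exists2 F, short_functions F & code F = c) ->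
    short_functions G /\ code G = c.
  move=> c; have [[F sF Fc]|nF] := pselect (exists2 F, short_functions F & code F = c).
    by exists F.
  by exists (fun=> 0) => /nF.
have nl : \forall m \near l, forall c : {ffun 'I_(size s) -> 'I_N}, short_functions (rep c) ->
    `|radon_integral (rep c) m - radon_integral (rep c) l| <= d.
  apply: (@filter_forall _ {ffun 'I_(size s) -> 'I_N} (fun c => [set m |
    short_functions (rep c) ->
    `|radon_integral (rep c) m - radon_integral (rep c) l| <= d]) _ (nbhs_filter l)) => c.
  have [sc|nsc] := pselect (short_functions (rep c)); last by apply: nearW => m /nsc.
  have [cc _ _] := sc.
  have /cvgrPdist_le/(_ _ d0) := radon_integral_continuous cc (x := l).
  by move=> near_c; apply: filterS near_c => m; rewrite distrC => ml _.
(* The total error is [3 * d + d + 3 * d], below [eps = 8 * d]. *)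
apply: filterS nl => m ml; apply: short_dist_le => F sF.
have [sG GF] := repP (code F) (ex_intro2 _ _ F sF erefl).
have FG := code_dist _ _ sF sG (esym GF).
have cB := @sc_compact R X.
have [cF _ _] := sF; have [cG _ _] := sG.
have := dist_radon_integral cB m cF cG FG; have := dist_radon_integral cB l cF cG FG.
by have := ml _ sG; rewrite !ler_norml /d; lra.
Qed.

Lemma short_dist_continuous l : continuous (fun m => short_dist m l).
Proof.
move=> m; apply/(cvgrPdist_le (FF := nbhs_filter m)) => eps eps0.
apply: (@filterS _ _ (nbhs_filter m) _ _ _ (short_dist_near m eps0)) => q.
rewrite short_distC => mq; rewrite ler_norml.
have := short_dist_triangle q m l; have := short_dist_triangle m q l.
by rewrite (short_distC q m); lra.
Qed.

(** A small positive multiple of [F] is a short function. *)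
Lemma lipschitz_integral (l l' : K) (L : R) (f : X -> R) (F : B -> R) :
  short_dist l l' = 0 -> continuous F -> (forall x, F (e x) = f x) ->
  (forall a b, `|f a - f b| <= L * rho a b) ->
  radon_integral F l = radon_integral F l'.
Proof.
move=> ll' cF FE fL; have cB := @sc_compact R X.
have [M FM] := compact_continuous_bounded cB cF.
pose t := (`|L| + `|M| + 1)^-1.
have t0 : 0 < t by rewrite invr_gt0 ltr_wpDl// addr_ge0.
have tL : t * L <= 1.
  rewrite mulrC ler_pdivrMr ?mul1r; last by rewrite -invr_gt0.
  by have := ler_norm L; have := normr_ge0 M; lra.
have tM : t * M <= 1.
  rewrite mulrC ler_pdivrMr ?mul1r; last by rewrite -invr_gt0.
  by have := ler_norm M; have := normr_ge0 L; lra.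
have sF : short_functions (fun z => t * F z).
  split=> [|a b|z].
  - by move=> z; exact: (cvgM (cvg_cst _) (cF z)).
  - rewrite -mulrBr !FE normrM (gtr0_norm t0).
    rewrite (le_trans (ler_wpM2l (ltW t0) (fL a b)))// mulrA.
    by rewrite ler_piMl.
  - by rewrite normrM (gtr0_norm t0) (le_trans _ tM)// ler_wpM2l// ltW.
have := short_dist_ub l l' sF; rewrite ll' !radon_integralZ// -mulrBr.
by rewrite normr_le0 mulf_eq0 gt_eqF//= subr_eq0 => /eqP.
Qed.

(* Otherwise the infimal convolution of [f] with a large multiple of [rho] lies,
   up to [d / 2], between [c - k] and [f]; it is Lipschitz, so its integrals for
   [l] and [l'] agree, which is absurd. *)
Lemma coupled_points (f k : B -> R) (l l' : K) (d : R) : continuous f ->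
  continuous k -> 0 < d -> short_dist l l' = 0 ->
  exists x y, rho x y = 0 /\
    f (e x) + k (e y) <= radon_integral f l + radon_integral k l' + d.
Proof.
move=> cf ck d0 ll'; have cB := @sc_compact R X.
set c := _ + _ + d; apply: contrapT => nxy.
have fk x y : rho x y = 0 -> c < f (e x) + k (e y).
  by move=> xy; rewrite ltNge; apply/negP => fkc; apply: nxy; exists x, y.
have [Mf fM] := compact_continuous_bounded cB cf.
have [Mk kM] := compact_continuous_bounded cB ck.
have Mf0 : 0 <= Mf := le_trans (normr_ge0 _) (fM (e point)).
have Mk0 : 0 <= Mk := le_trans (normr_ge0 _) (kM (e point)).
have d8 : 0 < d / 8 by rewrite divr_gt0.
have cfe : continuous (f \o e).
  by move=> x; apply: continuous_comp; [exact: sc_embed_continuous|exact: cf].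
have cke : continuous (k \o e).
  by move=> x; apply: continuous_comp; [exact: sc_embed_continuous|exact: ck].
have open_near (F : X -> R) (a : X) (r : R) :
    continuous F -> open [set x | `|F x - F a| < r].
  move=> cF; apply: (@open_comp _ _ (fun x => `|F x - F a|) [set t | t < r]); last exact: open_lt.
  by move=> x _; exact: (cvg_norm (cvgB (cF x) (cvg_cst _))).
(* Otherwise every [n] has a violating pair [p n]. Boxes around these pairs cluster at a pair of
   [rho]-distance [0], against [fk]. *)
have [n nP] : exists n : nat, forall x z,
    c - d / 2 <= f (e z) + n.+1%:R * rho x z + k (e x).
  apply: contrapT => /forallNP nn.
  have /choice[p pP] : forall n : nat, exists p : X * X,
      f (e p.2) + n.+1%:R * rho p.1 p.2 + k (e p.1) < c - d / 2.
    move=> n; apply: contrapT => np; apply: (nn n) => x z; rewrite leNgt.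
    by apply/negP => xz; apply: np; exists (x, z).
  pose U n i := if i == 0%N then
      [set x | rho x (p n).1 < n.+1%:R^-1] `&`
      [set x | `|k (e x) - k (e (p n).1)| < d / 8]
    else [set x | rho x (p n).2 < n.+1%:R^-1] `&`
      [set x | `|f (e x) - f (e (p n).2)| < d / 8].
  have [||z zP] := box_cluster crX pY 1 (U := U).
  - move=> n i; rewrite /U; case: ifP => _; apply: openI; try exact: pseudometric_open_ball.
      exact: (open_near _ _ _ cke).
    exact: (open_near _ _ _ cfe).
  - move=> n i; rewrite /U; case: ifP => _; [exists (p n).1|exists (p n).2];
      by split; rewrite /= ?rhoxx ?subrr ?normr0 ?invr_gt0.
  have key eps : 0 < eps -> exists n x y, [/\ (n.+1%:R^-1 <= eps) , rho x (z 0%N) < eps,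
      rho y (z 1%N) < eps, U n 0%N x & U n 1%N y] /\
      `|k (e x) - k (e (z 0%N))| < d / 8 /\ `|f (e y) - f (e (z 1%N))| < d / 8.
    move=> eps0; pose N i := [set x | rho x (z i) < eps] `&`
        ([set x | `|k (e x) - k (e (z i))| < d / 8] `&`
         [set x | `|f (e x) - f (e (z i))| < d / 8]).
    have NP i : open (N i) /\ N i (z i).
      split; last by rewrite /N; split; [|split]; rewrite /= ?rhoxx ?subrr ?normr0.
      apply: openI; first exact: pseudometric_open_ball.
      by apply: openI; [exact: (open_near _ _ _ cke)|exact: (open_near _ _ _ cfe)].
    have [n nN nP] := zP N NP (Num.truncn eps^-1).
    have [x [[xz [kx _]] Ux]] := nP 0%N erefl.
    have [y [[yz [_ fy]] Uy]] := nP 1%N erefl.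
    exists n, x, y; split => //; split => //.
    rewrite -[eps]invrK lef_pV2 ?posrE ?invr_gt0//; apply/ltW.
    by apply: lt_le_trans (truncnS_gt _) _; rewrite ler_nat ltnS.
  have z01 : rho (z 0%N) (z 1%N) = 0.
    apply/le_anti; rewrite rho_ge0 andbT; apply/ler_addgt0Pl => eps eps0; rewrite addr0.
    (* Boundedness of [f] and [k] keeps [n.+1 * rho (p n).1 (p n).2] below [C]; the path from [z 0]
       to [z 1] through [x], [p n] and [y] then costs at most [(C + 4) * r]. *)
    pose C := `|c| + Mf + Mk; have C0 : 0 <= C by rewrite /C !addr_ge0.
    have C4 : 0 < C + 4 by rewrite ltr_wpDl.
    pose r := eps / (C + 4); have r0 : 0 < r by rewrite divr_gt0.
    have epsE : eps = (C + 4) * r by rewrite /r mulrC divfK// gt_eqF.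
    have [n [x [y [[nr xz yz [/= xp _] [/= yp _]] _]]]] := key r r0.
    have pC : rho (p n).1 (p n).2 <= C * r.
      have n0 : 0 < n.+1%:R^-1 :> R by rewrite invr_gt0.
      apply: (@le_trans _ _ (C * n.+1%:R^-1)); last by rewrite ler_wpM2l.
      rewrite ler_pdivlMr// mulrC; have := pP n; have := fM (e (p n).2); have := kM (e (p n).1).
      have := ler_norm c; have := ler_norm (- c); rewrite normrN !ler_norml /C.
      by move: (_ * rho _ _) (`|c|) => q nc; lra.
    have := rho_triangle x (z 0%N) (z 1%N); have := rho_triangle (p n).1 x (z 1%N).
    have := rho_triangle (p n).2 (p n).1 (z 1%N); have := rho_triangle y (p n).2 (z 1%N).
    rewrite (rhoC (z 0%N) x) (rhoC (p n).2 y) epsE mulrDl.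
    by move: (C * r) pC (n.+1%:R^-1) nr xp yp => s sp q qr xq yq; lra.
  (* Four oscillations below [d / 8] cannot bridge the margin [d / 2] between [pP] and [fk]. *)
  have [n [x [y [[_ _ _ [_ kx] [_ fy]] [kz fz]]]]] := key 1 ltr01.
  have := pP n; have := fk _ _ (etrans (rhoC _ _) z01).
  have : 0 <= n.+1%:R * rho (p n).1 (p n).2 by rewrite mulr_ge0.
  by move: kx fy kz fz; rewrite /= !ltr_norml; lra.
pose phi x := inf [set f (e z) + n.+1%:R * rho x z | z in [set: X]].
have hasinf x : has_inf [set f (e z) + n.+1%:R * rho x z | z in [set: X]].
  split; first by exists (f (e x) + n.+1%:R * rho x x), x.
  exists (- Mf) => _ [z _ <-]; have := fM (e z); rewrite ler_norml => /andP[fz _].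
  by rewrite (le_trans fz)// lerDl mulr_ge0.
have phi_le x z : phi x <= f (e z) + n.+1%:R * rho x z.
  by apply: ge_inf; [have [] := hasinf x|exists z].
have le_phi x (r : R) : (forall z, r <= f (e z) + n.+1%:R * rho x z) -> r <= phi x.
  by move=> rP; apply: lb_le_inf; [have [] := hasinf x|move=> _ [z _ <-]].
have phiL a b : `|phi a - phi b| <= n.+1%:R * rho a b.
  have H a' b' : phi a' - n.+1%:R * rho a' b' <= phi b'.
    apply: le_phi => z; rewrite lerBlDr (le_trans (phi_le a' z))// -addrA lerD2l.
    by rewrite -mulrDr ler_wpM2l// addrC.
  by rewrite ler_norml; have := H a b; have := H b a; rewrite (rhoC b a); lra.
have cphi : continuous phi.
  move=> a; apply/cvgrPdist_le => eps eps0.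
  have e1 : 0 < eps / n.+1%:R by rewrite divr_gt0.
  apply: filterS (rho_near a e1) => b; rewrite ler_pdivlMr// => ba.
  by rewrite (le_trans (phiL a b))// rhoC mulrC.
have bphi : bounded_fun phi.
  apply/bounded_funP; exists Mf => x; rewrite ler_norml; apply/andP; split.
    apply: le_phi => z; have := fM (e z); rewrite ler_norml => /andP[fz _].
    by rewrite (le_trans fz)// lerDl mulr_ge0.
  rewrite (le_trans (phi_le x x))// rhoxx mulr0 addr0.
  exact: le_trans (ler_norm _) (fM _).
have [F cF FE] := sc_extension cphi bphi.
have Ff : radon_integral F l <= radon_integral f l.
  apply: le_radon_integral => //; apply: sc_le => // x.
  by rewrite FE (le_trans (phi_le x x))// rhoxx mulr0 addr0.
have cck : continuous (fun z => c - d / 2 - k z).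
  by move=> z; exact: (cvgB (cvg_cst _) (ck z)).
have kF : radon_integral (fun z => c - d / 2 - k z) l' <= radon_integral F l'.
  apply: le_radon_integral => //; apply: sc_le => // x.
  by rewrite FE; apply: le_phi => z; have := nP x z; lra.
(* Chaining the inequalities through [F] bounds [c - d / 2] by the sum of the two integrals, which
   is [c - d]. *)
have := lipschitz_integral ll' cF FE phiL.
move: kF; rewrite radon_integralB ?radon_integral_cst//; last exact: cst_continuous.
by rewrite /c; lra.
Qed.

(** * Simultaneous approximation of two measures by averages *)

Lemma radon_integral_comb (I : Type) (r : seq I) (c : I -> R) (F : I -> B -> R)
    (l : K) :
  (forall i, continuous (F i)) ->
  radon_integral (fun z => \sum_(i <- r) c i * F i z) l =
  \sum_(i <- r) c i * radon_integral (F i) l.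
Proof.
move=> cF; have cB := @sc_compact R X.
have cc i : continuous (fun z => c i * F i z).
  by move=> z; exact: (cvgM (cvg_cst _) (cF i z)).
elim: r => [|i r ih].
  by under eq_fun do rewrite big_nil; rewrite big_nil radon_integral_cst.
under eq_fun do rewrite big_cons; rewrite big_cons -ih.
by rewrite radon_integralD ?radon_integralZ//; exact: continuous_sumr.
Qed.

(* Greedy choice of points: each new pair correlates nonpositively, up to [1/2],
   with the accumulated error, so the squared error of the sums grows only
   linearly. *)
Lemma coupled_sums (m : nat) (F : 'I_m -> B -> R) (l l' : K) :
  (forall j, continuous (F j)) -> short_dist l l' = 0 ->
  exists C : R, forall k, exists x y : nat -> X, (forall i, rho (x i) (y i) = 0) /\
    \sum_j ((\sum_(i < k) (F j (e (x i)) - radon_integral (F j) l)) ^+ 2 +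
            (\sum_(i < k) (F j (e (y i)) - radon_integral (F j) l')) ^+ 2)
    <= k%:R * C.
Proof.
move=> cF ll'; have cB := @sc_compact R X.
pose p j := radon_integral (F j) l; pose q j := radon_integral (F j) l'.
have /choice[M MP] : forall j, exists M : R, forall z,
    (F j z - p j) ^+ 2 + (F j z - q j) ^+ 2 <= M.
  move=> j; have cG : continuous (fun z => (F j z - p j) ^+ 2 + (F j z - q j) ^+ 2).
    have cD r : continuous (fun z => F j z - r).
      by move=> z; exact: (cvgB (cF j z) (cvg_cst _)).
    have cD2 r : continuous (fun z => (F j z - r) ^+ 2).
      by under eq_fun do rewrite expr2; move=> z; exact: (cvgM (cD r z) (cD r z)).
    by move=> z; exact: (cvgD (cD2 _ z) (cD2 _ z)).
  have [M GM] := compact_continuous_bounded cB cG.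
  by exists M => z; exact: le_trans (ler_norm _) (GM z).
have M0 j z z' : (F j z - p j) ^+ 2 + (F j z' - q j) ^+ 2 <= 2 * M j.
  have := MP j z; have := MP j z'; have := sqr_ge0 (F j z - q j); have := sqr_ge0 (F j z' - p j).
  lra.
(* [2 * M j] bounds the new squares; [1] is twice the error [1 / 2] in the cross term. *)
exists (1 + \sum_j 2 * M j); elim=> [|k [x [y [xy Ek]]]].
  exists (fun=> point), (fun=> point); split=> [i|]; first exact: rhoxx.
  by rewrite big1 ?mul0r// => j _; rewrite !big_ord0 expr0n/= addr0.
pose T j := \sum_(i < k) (F j (e (x i)) - p j).
pose S j := \sum_(i < k) (F j (e (y i)) - q j).
have cT : continuous (fun z => \sum_j T j * F j z).
  by apply: continuous_sumr => j z; exact: (cvgM (cvg_cst _) (cF j z)).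
have cS : continuous (fun z => \sum_j S j * F j z).
  by apply: continuous_sumr => j z; exact: (cvgM (cvg_cst _) (cF j z)).
have h0 : 0 < 1 / 2 :> R by lra.
(* The test functions are weighted by the errors [T] and [S] accumulated so far. *)
have [a [b [ab]]] := coupled_points cT cS h0 ll'.
rewrite !radon_integral_comb// -/p => corr.
exists (update x k a), (update y k b); split=> [i|].
  by rewrite /update; case: ifP.
have step (z : nat -> X) c j r : \sum_(i < k.+1) (F j (e (update z k c i)) - r) =
    \sum_(i < k) (F j (e (z i)) - r) + (F j (e c) - r).
  rewrite big_ord_recr/= {2}/update eqxx; congr (_ + _); apply: eq_bigr => i _.
  by rewrite /update ltn_eqF.
under eq_bigr => j _ do rewrite !step -/(p j) -/(q j) -/(T j) -/(S j).
have -> : \sum_j ((T j + (F j (e a) - p j)) ^+ 2 + (S j + (F j (e b) - q j)) ^+ 2) =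
  \sum_j (T j ^+ 2 + S j ^+ 2) +
  2 * ((\sum_j T j * F j (e a) + \sum_j S j * F j (e b)) -
       (\sum_j T j * p j + \sum_j S j * q j)) +
  \sum_j ((F j (e a) - p j) ^+ 2 + (F j (e b) - q j) ^+ 2).
  rewrite -!big_split -sumrB mulr_sumr -!big_split/=; apply: eq_bigr => j _.
  by rewrite !expr2; lra.
rewrite -natr1 mulrDl mul1r.
have : \sum_j ((F j (e a) - p j) ^+ 2 + (F j (e b) - q j) ^+ 2) <= \sum_j 2 * M j.
  by apply: ler_sum => j _.
by move: Ek corr; rewrite -/p -/q; lra.
Qed.

(** A sum with square at most [n.+1 * C] has a mean with square at most [C / n.+1], which is below
    [eps ^+ 2] for large [n]. *)
Lemma coupled_averages (s : seq (B -> R)) (l l' : K) (eps : R) :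
  (forall F, List.In F s -> continuous F) -> 0 < eps -> short_dist l l' = 0 ->
  exists n (x y : nat -> X), (forall i, rho (x i) (y i) = 0) /\
    forall F, List.In F s ->
    `|tau_integral F (average R n x) - radon_integral F l| < eps /\
    `|tau_integral F (average R n y) - radon_integral F l'| < eps.
Proof.
move=> cs eps0 ll'.
have sP F : List.In F s -> exists j : 'I_(size s), F = nth (fun=> 0) s j.
  elim: s {cs} => [//|G s ih] [<-|/ih[j ->]]; first by exists ord0.
  by exists (lift ord0 j).
have cF (j : 'I_(size s)) : continuous (nth (fun=> 0) s j).
  apply: cs; case: j => j /=; elim: s {sP} j => [//|G s ih] [|j] js; first by left.
  by right; exact: ih.
have [C CP] := coupled_sums cF ll'.
pose n := Num.truncn (`|C| / eps ^+ 2); have e20 : 0 < eps ^+ 2 by rewrite exprn_gt0.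
have [x [y [xy En]]] := CP n.+1.
have small (t : R) : t ^+ 2 <= n.+1%:R * C -> `|n.+1%:R^-1 * t| < eps.
  move=> tC; rewrite -(ltr_pXn2r (n := 2)) ?nnegrE ?(ltW eps0)//.
  rewrite -normrX ger0_norm ?sqr_ge0// exprMn exprVn.
  rewrite mulrC ltr_pdivrMr ?exprn_gt0// (le_lt_trans tC)//.
  rewrite expr2 mulrCA ltr_pM2l//.
  have := truncnS_gt (`|C| / eps ^+ 2); rewrite -/n ltr_pdivrMr// mulrC.
  exact: le_lt_trans (ler_norm _).
exists n, x, y; split => // F /sP[j ->].
have mean (z : nat -> X) (r : R) :
    n.+1%:R^-1 * (\sum_(i < n.+1) nth (fun=> 0) s j (e (z i))) - r =
    n.+1%:R^-1 * \sum_(i < n.+1) (nth (fun=> 0) s j (e (z i)) - r).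
  by rewrite sumrB mulrBr sumr_const card_ord -[r *+ _]mulr_natl mulKf ?pnatr_eq0.
rewrite !tau_integral_average// !mean.
move: En; rewrite (bigD1 j)//=.
set rest := (X in _ + X <= _) => En.
have r0 : 0 <= rest.
  by apply: sumr_ge0 => i _; rewrite addr_ge0 ?sqr_ge0.
split; apply: small.
  by apply: le_trans En; rewrite -addrA lerDl addr_ge0// sqr_ge0.
by apply: le_trans En; rewrite addrAC lerDr addr_ge0// sqr_ge0.
Qed.

End lipschitz_distance.

(** * Extension *)

Section extension.
Context (R : realType) (X : ptopologicalType).
Hypothesis crX : completely_regular_space X.
Local Notation B := (stone_cech R X).
Local Notation K := (radon_prob R B).
Local Notation Y := (P_tau R X).
Hypothesis pY : pseudocompact R Y.
Variables (g : Y -> R) (M : R).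
Hypotheses (cg : continuous g) (gM : forall y, `|g y| <= M).

Let rho := exchange_dist g.
Let W : K -> K -> R := short_dist rho.

Let rho_ge0 a b : 0 <= rho a b := exchange_dist_ge0 gM a b.
Let rhoxx a : rho a a = 0 := exchange_distxx gM a.
Let rhoC a b : rho a b = rho b a := exchange_distC gM a b.
Let rho_triangle b a c : rho a c <= rho a b + rho b c :=
  exchange_dist_triangle gM b a c.
Let rho_near b (eps : R) : 0 < eps -> \forall a \near b, rho a b <= eps :=
  exchange_dist_near gM crX pY cg b (eps := eps).

Let W_continuous l : continuous (fun y : Y => W (set_val y) l).
Proof.
move=> y; apply: (@continuous_comp Y K R set_val (fun m => W m l)).
  exact: initial_continuous.
exact: (short_dist_continuous crX pY rho_ge0 rhoxx rhoC rho_triangle rho_near).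
Qed.

(** Averages of points [a i] and [b i] with [rho (a i) (b i) = 0] approximate [y] and [y'], and [g]
    agrees on such averages. *)
Lemma short_dist0_eq (y y' : Y) : W (set_val y) (set_val y') = 0 -> g y = g y'.
Proof.
move=> yy'; apply/eqP; rewrite -subr_eq0 -normr_le0.
apply/ler_addgt0Pl => eps eps0; rewrite addr0.
have e2 : 0 < eps / 2 by rewrite divr_gt0.
have near_g (q : Y) : nbhs q [set z | `|g q - g z| < eps / 2].
  by have /cvgrPdist_lt/(_ _ e2) := @cg q.
have [s [d [d0 sc sP]]] := P_tau_nbhsP (near_g y).
have [s' [d' [d'0 sc' sP']]] := P_tau_nbhsP (near_g y').
have m0 : 0 < Num.min d d' by rewrite lt_min d0.
have [|n [a [b [ab abP]]]] := coupled_averages crX pY rho_ge0 rhoxx rhoC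
  rho_triangle rho_near (s := s ++ s') _ m0 yy'.
  by move=> F /List.in_app_iff[/sc|/sc'].
have gab := exchange_dist0 gM cg n ab.
have : `|g y - g (average R n a)| < eps / 2.
  apply: sP => F Fs; have [+ _] := abP F (proj2 (List.in_app_iff _ _ _) (or_introl Fs)).
  by rewrite lt_min => /andP[].
have : `|g y' - g (average R n b)| < eps / 2.
  apply: sP' => F Fs; have [_] := abP F (proj2 (List.in_app_iff _ _ _) (or_intror Fs)).
  by rewrite lt_min => /andP[].
by rewrite gab ler_norml !ltr_norml; lra.
Qed.

(** Otherwise the distance to [l] is positive on [Y], hence at least some [d > 0], although averages
    of points of [X] come within [d / 2] of [l]. *)
Lemma short_dist0_ex (l : K) : exists y : Y, W (set_val y) l = 0.
Proof.
apply: contrapT => /forallNP Wl.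
have W0 (y : Y) : 0 < W (set_val y) l.
  rewrite lt_neqAle eq_sym; apply/andP; split; first exact/eqP/Wl.
  exact: short_dist_ge0.
have [d d0 dW] := pseudocompact_lower_bound pY (W_continuous (l := l)) W0.
have d2 : 0 < d / 2 by rewrite divr_gt0.
have [s [c [c0 sc sP]]] := radon_nbhsP
  (short_dist_near crX pY rho_ge0 rhoxx rhoC rho_triangle rho_near l d2).
have [n [a [b [_ abP]]]] := coupled_averages crX pY rho_ge0 rhoxx rhoC
  rho_triangle rho_near sc c0 (short_distxx rho_ge0 l).
have := sP (set_val (average R n a)) (fun F Fs => (abP F Fs).1).
by have := dW (average R n a); rewrite /= /W; lra.
Qed.

Lemma P_tau_extension :
  exists2 H : K -> R, continuous H & forall y : Y, H (set_val y) = g y.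
Proof.
have /choice[y_ yP] := short_dist0_ex; exists (g \o y_); last first.
  by move=> y; apply: short_dist0_eq; exact: yP.
move=> l0; apply/(cvgrPdist_lt (FF := nbhs_filter l0)) => eps eps0.
pose y0 := y_ l0.
(* Where the first term vanishes, [g y = g y0] and the second is [eps], so [u] is positive. A lower
   bound [d] of [u] yields [|g y - g y0| < eps] whenever [W] is below [d]. *)
pose u (y : Y) := W (set_val y) (set_val y0) + Num.max 0 (eps - `|g y - g y0|).
have cgap : continuous (fun y => eps - `|g y - g y0|).
  by move=> y; exact: (cvgB (cvg_cst _) (cvg_norm (cvgB (@cg y) (cvg_cst _)))).
have cmax : continuous (fun y : Y => Num.max 0 (eps - `|g y - g y0|)).
  move=> y; apply: (@continuous_max R Y (fun=> 0) (fun y => eps - `|g y - g y0|)).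
    exact: cst_continuous.
  exact: cgap.
have cW := @W_continuous (set_val y0).
have cu : continuous u by move=> y; exact: (cvgD (cW y) (cmax y)).
have W0 l l' : 0 <= W l l' by exact: short_dist_ge0.
have u0 y : 0 < u y.
  have [Wy|Wy] := eqVneq (W (set_val y) (set_val y0)) 0.
    by rewrite /u Wy (short_dist0_eq Wy) subrr normr0 subr0 add0r lt_max eps0 orbT.
  by rewrite ltr_pwDl ?le_max ?lexx// lt_neqAle eq_sym Wy W0.
have [d d0 du] := pseudocompact_lower_bound pY cu u0.
have d2 : 0 < d / 2 by rewrite divr_gt0.
apply: (@filterS _ _ (nbhs_filter l0) _ _ _
  (short_dist_near crX pY rho_ge0 rhoxx rhoC rho_triangle rho_near l0 d2)) => l ll0.
rewrite /= -/y0 distrC ltNge; apply/negP => gl.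
have := du (y_ l); rewrite /u (max_idPl _); last by rewrite subr_le0.
(* The outer two terms vanish by the choice of [y_], leaving at most [d / 2]. *)
have : W (set_val (y_ l)) (set_val y0) <=
    W (set_val (y_ l)) l + (W l l0 + W l0 (set_val y0)).
  apply: le_trans (short_dist_triangle rho_ge0 l _ _) _; rewrite lerD2l.
  exact: short_dist_triangle.
rewrite yP [W l0 _]short_distC// -/W yP.
have : W l l0 <= d / 2 by [].
by lra.
Qed.

End extension.
Theorem theorem1p26 (R : realType) (X : ptopologicalType) :
  tychonoff_space X ->
  precaliber_omega1 X ->
  pseudocompact R (P_tau R X) ->
  Cstar_embedded R (P_tau R X).
Proof.
move=> [_ crX] _ pY g cg /bounded_funP[M gM].
exact: (P_tau_extension crX pY cg gM).
Qed.
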